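(* Let $n,k\ge1$ and let $V$ and $V'$ be modules over $\mathfrak{gl}_n$ and $\mathfrak{gl}_k$ respectively that are in an unnormalized algebraic Howe duality with each other. Let $q=q_V$ and $q'=q_{V'}$ be their minimal polynomials. Then in $\mathbb{C}[u]$ $$q(u)\ \big|\ u\,q'(u+k-n)\qquad\text{and}\qquad q'(u)\ \big|\ u\,q(u-k+n).$$
   Context: The ground field is $\mathbb{C}$. Minimal polynomial. For $m\ge 1$ let $\mathfrak{gl}_m$ have the basis of matrix units $E_{ij}$, $1\le i,j\le m$, with $[E_{ij},E_{kl}]=\delta_{jk}E_{il}-\delta_{li}E_{kj}$, and let $(E_{ij})$ be the $m\times m$ matrix over $U(\mathfrak{gl}_m)$ whose $(i,j)$ entry is the generator $E_{ij}$. The minimal polynomial of a $\mathfrak{gl}_m$-module $V$ is the nonzero monic polynomial $q_V\in\mathbb{C}[u]$ of minimal degree such that every entry of the matrix $q_V((E_{ij}))$ (matrix powers over $U(\mathfrak{gl}_m)$) acts by $0$ on $V$; the modules $V$ and $V'$ in the claim are those for which the minimal polynomials are defined. Write $E$ for the $n\times n$ matrix of generators of $\mathfrak{gl}_n$ and $E'$ for the $k\times k$ matrix of generators of $\mathfrak{gl}_k$. Weyl algebra and embeddings. Let $\mathcal{W}$ be the algebra of polynomial coefficient differential operators on the space of $k\times n$ matrices, with coordinate functions $x_{ai}$ and partial derivatives $\partial_{ai}$ ($1\le a\le k$, $1\le i\le n$). Let $X=(x_{ai})$ and $D=(\partial_{ai})$ be the corresponding $k\times n$ matrices. The unnormalized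 embeddings $L:\mathfrak{gl}_k\to\mathcal W$ and $R:\mathfrak{gl}_n\to\mathcal W$ are the Lie algebra homomorphisms given by $L(E')=XD^t$, $R(E)=X^tD$, i.e. $L(E'_{ab})=\sum_i x_{ai}\partial_{bi}$ and $R(E_{ij})=\sum_a x_{ai}\partial_{aj}$. Every $\mathcal W$-module becomes a $\mathfrak{gl}_n$-module and a $\mathfrak{gl}_k$-module (with commuting actions) by pulling back along $R$ and $L$. Unnormalized algebraic Howe duality. A $\mathfrak{gl}_n$-module $V$ and a $\mathfrak{gl}_k$-module $V'$ (both nonzero) are in unnormalized algebraic Howe duality with each other if there are a nonzero $\mathcal W$-module $\mathcal A$ and a subspace $\mathcal A_0\subset\mathcal A$ invariant under the actions of $\mathfrak{gl}_n$ (via $R$) and $\mathfrak{gl}_k$ (via $L$) such that $\mathcal A/\mathcal A_0$ is isomorphic to $V\otimes V'$ as a $\mathfrak{gl}_n$-module and a $\mathfrak{gl}_k$-module (i.e. compatibly with both actions). *)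

(* Defs.v *)
From HB Require Import structures.
From mathcomp Require Import all_boot all_order all_algebra finmap.
From mathcomp Require Import boolp reals complex.
From mathcomp Require Import mpoly monalg.

Set Implicit Arguments.
Unset Strict Implicit.
Unset Printing Implicit Defensive.

Import GRing.Theory.
Local Open Scope ring_scope.

(* endo V is the F-algebra of linear endomorphisms of V, with product f \o g;
   V may be zero or infinite-dimensional. *)
Definition endo (F : fieldType) (V : lmodType F) : Type := {linear V -> V}.

Definition endo_fun (F : fieldType) (V : lmodType F) (f : endo V) : V -> V :=
  (f : {linear V -> V}).
Coercion endo_fun : endo >-> Funclass.

Section Endo.
Variables (F : fieldType) (V : lmodType F).
Implicit Types (f g h : endo V) (c : F).

Lemma endoP f g : f =1 g -> f = g.
Proof.
case: f g => [f [[f1] [f2]]] [g [[g1] [g2]]] /= /funext efg.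
rewrite /endo_fun /= in efg; rewrite efg in f1 f2 *.
by rewrite (Prop_irrelevance f1 g1) (Prop_irrelevance f2 g2).
Qed.

Lemma endo_linear f : linear f.
Proof. by move=> c u v; rewrite /endo_fun linearP. Qed.

Definition mk_endo (f : V -> V) (lf : linear f) : endo V :=
  HB.pack_for {linear V -> V} f (GRing.isLinear.Build F V V *:%R f lf).

Lemma mk_endoE f lf v : @mk_endo f lf v = f v. Proof. by []. Qed.

HB.instance Definition _ := gen_eqMixin (endo V).
HB.instance Definition _ := gen_choiceMixin (endo V).

Fact endo_zero_subproof : linear (fun _ : V => 0 : V).
Proof. by move=> c u v; rewrite scaler0 addr0. Qed.
Fact endo_opp_subproof f : linear (fun v => - f v).
Proof. by move=> c u v; rewrite endo_linear opprD scalerN. Qed.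
Fact endo_add_subproof f g : linear (fun v => f v + g v).
Proof. by move=> c u v; rewrite !endo_linear scalerDr addrACA. Qed.
Fact endo_one_subproof : linear (fun v : V => v).
Proof. by []. Qed.
Fact endo_mul_subproof f g : linear (fun v => f (g v)).
Proof. by move=> c u v; rewrite !endo_linear. Qed.
Fact endo_scale_subproof a f : linear (fun v => a *: f v).
Proof.
by move=> c u v; rewrite endo_linear scalerDr !scalerA mulrC.
Qed.

Definition endo_zero := mk_endo endo_zero_subproof.
Definition endo_opp f := mk_endo (endo_opp_subproof f).
Definition endo_add f g := mk_endo (endo_add_subproof f g).
Definition endo_one := mk_endo endo_one_subproof.
Definition endo_mul f g := mk_endo (endo_mul_subproof f g).
Definition endo_scale c f := mk_endo (endo_scale_subproof c f).

Fact endo_addA : associative endo_add.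
Proof. by move=> f g h; apply: endoP => v; apply: addrA. Qed.
Fact endo_addC : commutative endo_add.
Proof. by move=> f g; apply: endoP => v; apply: addrC. Qed.
Fact endo_add0 : left_id endo_zero endo_add.
Proof. by move=> f; apply: endoP => v; apply: add0r. Qed.
Fact endo_addN : left_inverse endo_zero endo_opp endo_add.
Proof. by move=> f; apply: endoP => v; apply: addNr. Qed.

HB.instance Definition _ := GRing.isZmodule.Build (endo V)
  endo_addA endo_addC endo_add0 endo_addN.

Fact endo_mulA : associative endo_mul.
Proof. by move=> f g h; apply: endoP. Qed.
Fact endo_mul1 : left_id endo_one endo_mul.
Proof. by move=> f; apply: endoP. Qed.
Fact endo_mulr1 : right_id endo_one endo_mul.
Proof. by move=> f; apply: endoP. Qed.
Fact endo_mulDl : left_distributive endo_mul +%R.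
Proof. by move=> f g h; apply: endoP. Qed.
Fact endo_mulDr : right_distributive endo_mul +%R.
Proof.
move=> f g h; apply: endoP => v.
exact: (raddfD (f : {linear V -> V})).
Qed.

HB.instance Definition _ := GRing.Zmodule_isPzRing.Build (endo V)
  endo_mulA endo_mul1 endo_mulr1 endo_mulDl endo_mulDr.

Fact endo_scaleA a b f : endo_scale a (endo_scale b f) = endo_scale (a * b) f.
Proof. by apply: endoP => v; apply: scalerA. Qed.
Fact endo_scale1 : left_id 1 endo_scale.
Proof. by move=> f; apply: endoP => v; apply: scale1r. Qed.
Fact endo_scaleDr : right_distributive endo_scale +%R.
Proof. by move=> c f g; apply: endoP => v; apply: scalerDr. Qed.
Fact endo_scaleDl f : {morph endo_scale^~ f : a b / a + b}.
Proof. by move=> a b; apply: endoP => v; apply: scalerDl. Qed.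

HB.instance Definition _ := GRing.Zmodule_isLmodule.Build F (endo V)
  endo_scaleA endo_scale1 endo_scaleDr endo_scaleDl.

Lemma endo_scaleAl c f g : (c *: f) * g = c *: (f * g).
Proof. by apply: endoP. Qed.
Lemma endo_scaleAr c f g : f * (c *: g) = c *: (f * g).
Proof. by apply: endoP => v; apply: (linearZ_LR (f : {linear V -> V})). Qed.

Lemma endo0E v : (0 : endo V) v = 0. Proof. by []. Qed.
Lemma endoDE f g v : (f + g) v = f v + g v. Proof. by []. Qed.
Lemma endoNE f v : (- f) v = - f v. Proof. by []. Qed.
Lemma endo1E v : (1 : endo V) v = v. Proof. by []. Qed.
Lemma endoME f g v : (f * g) v = f (g v). Proof. by []. Qed.
Lemma endoZE c f v : (c *: f) v = c *: f v. Proof. by []. Qed.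

End Endo.

Section QuotModule.
Variables (F : fieldType) (V : lmodType F) (S : submodClosed V).
Local Open Scope quotient_scope.

Fact submod_zmod_closed : zmod_closed S.
Proof.
split=> [|u v Su Sv]; first exact: rpred0.
by rewrite -scaleN1r rpredD // rpredZ.
Qed.

Definition submod_zmod : zmodClosed V :=
  HB.pack_for (zmodClosed V) (fun v => v \in S)
    (GRing.isZmodClosed.Build V (fun v => v \in S) submod_zmod_closed).

Definition quotmod : Type := Quotient.quot submod_zmod.

HB.instance Definition _ := GRing.Zmodule.on quotmod.

Definition quotmod_pi (v : V) : quotmod := \pi_(Quotient.quot submod_zmod) v.

Definition quotmod_repr (x : quotmod) : V :=
  repr (x : Quotient.quot submod_zmod).

Lemma quotmod_reprK x : quotmod_pi (quotmod_repr x) = x.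
Proof. exact: reprK. Qed.

Lemma quotmod_piP u v : reflect (quotmod_pi u = quotmod_pi v) (u - v \in S).
Proof. by rewrite (Quotient.idealrBE submod_zmod); apply: eqP. Qed.

Lemma quotmod_reprP v : quotmod_repr (quotmod_pi v) - v \in S.
Proof. by apply/quotmod_piP; rewrite quotmod_reprK. Qed.

Definition quotmod_scale (c : F) (x : quotmod) : quotmod :=
  quotmod_pi (c *: quotmod_repr x).

Lemma quotmod_scaleE c v : quotmod_scale c (quotmod_pi v) = quotmod_pi (c *: v).
Proof. by apply/quotmod_piP; rewrite -scalerBr rpredZ // quotmod_reprP. Qed.

Lemma quotmod_ind (P : quotmod -> Prop) :
  (forall v, P (quotmod_pi v)) -> forall x, P x.
Proof. by move=> Ppi x; rewrite -[x]quotmod_reprK. Qed.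

Lemma quotmod_piD u v : quotmod_pi (u + v) = quotmod_pi u + quotmod_pi v.
Proof. exact: (raddfD \pi_(Quotient.quot submod_zmod)). Qed.

Fact quotmod_scaleA a b x :
  quotmod_scale a (quotmod_scale b x) = quotmod_scale (a * b) x.
Proof. by elim/quotmod_ind: x => v; rewrite !quotmod_scaleE scalerA. Qed.
Fact quotmod_scale1 : left_id 1 quotmod_scale.
Proof. by elim/quotmod_ind=> v; rewrite quotmod_scaleE scale1r. Qed.
Fact quotmod_scaleDr : right_distributive quotmod_scale +%R.
Proof.
move=> c; elim/quotmod_ind=> u; elim/quotmod_ind=> v.
by rewrite -quotmod_piD !quotmod_scaleE scalerDr quotmod_piD.
Qed.
Fact quotmod_scaleDl x : {morph quotmod_scale^~ x : a b / a + b}.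
Proof.
move=> a b; elim/quotmod_ind: x => v.
by rewrite !quotmod_scaleE scalerDl quotmod_piD.
Qed.

HB.instance Definition _ := GRing.Zmodule_isLmodule.Build F quotmod
  quotmod_scaleA quotmod_scale1 quotmod_scaleDr quotmod_scaleDl.

Fact quotmod_pi_linear : linear quotmod_pi.
Proof. by move=> c u v; rewrite quotmod_piD -quotmod_scaleE. Qed.

HB.instance Definition _ := GRing.isLinear.Build F V quotmod *:%R quotmod_pi
  quotmod_pi_linear.

End QuotModule.

(* The map induced on V/S by f; meaningful only when f is compatible with S,
   see quotmod_liftE. *)
Definition quotmod_lift (F : fieldType) (V : lmodType F) (S : submodClosed V)
  (T : Type) (f : V -> T) (x : quotmod S) : T := f (quotmod_repr x).

Lemma quotmod_liftE (F : fieldType) (V : lmodType F) (S : submodClosed V)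
    (T : Type) (f : V -> T) (v : V) :
  (forall u w, u - w \in S -> f u = f w) ->
  quotmod_lift f (quotmod_pi S v) = f v.
Proof. by apply; apply: quotmod_reprP. Qed.

(* {malg F[K]} is the F-vector space with basis K; h extends linearly to it. *)
Definition free_lift (F : fieldType) (K : choiceType) (W : lmodType F)
  (h : K -> W) (x : {malg F[K]}) : W :=
  \sum_(k <- msupp x) mcoeff k x *: h k.

Section FreeLift.
Variables (F : fieldType) (K : choiceType) (W : lmodType F) (h : K -> W).

Lemma free_liftEw (d : {fset K}) (x : {malg F[K]}) : (msupp x `<=` d)%fset ->
  free_lift h x = \sum_(k <- d) mcoeff k x *: h k.
Proof.
move=> le; rewrite [LHS](big_fset_incl _ le) => //= k kd /mcoeff_outdom ->.
by rewrite scale0r.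
Qed.

Lemma free_liftU c k : free_lift h << c *g k >> = c *: h k.
Proof. by rewrite (free_liftEw msuppU_le) big_seq_fset1 mcoeffUU. Qed.

Fact free_lift_linear : linear (free_lift h).
Proof.
move=> c x y.
pose d := (msupp x `|` msupp y `|` msupp (c *: x + y))%fset.
have sx : (msupp x `<=` d)%fset by rewrite /d -fsetUA fsubsetUl.
have sy : (msupp y `<=` d)%fset by rewrite /d fsetUAC fsubsetUr.
rewrite (@free_liftEw d) ?fsubsetUr // (free_liftEw sx) (free_liftEw sy).
rewrite scaler_sumr -big_split /=; apply: eq_bigr => k _.
by rewrite mcoeffD mcoeffZ scalerDl scalerA.
Qed.

HB.instance Definition _ := GRing.isLinear.Build F {malg F[K]} W *:%R
  (free_lift h) free_lift_linear.
End FreeLift.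

Section Span.
Variables (F : fieldType) (V : lmodType F) (gens : V -> Prop).

Inductive in_span : V -> Prop :=
| in_span_gen v : gens v -> in_span v
| in_span0 : in_span 0
| in_spanD u v : in_span u -> in_span v -> in_span (u + v)
| in_spanZ c v : in_span v -> in_span (c *: v).

Definition span_pred (v : V) : bool := `[< in_span v >].

Fact span_submod_closed : subsemimod_closed span_pred.
Proof.
split=> [|c v /asboolP vS]; last exact/asboolP/in_spanZ.
split=> [|u v /asboolP uS /asboolP vS]; apply/asboolP; first exact: in_span0.
exact: in_spanD.
Qed.

Definition span : submodClosed V :=
  HB.pack_for (submodClosed V) span_pred
    (GRing.isSubmodClosed.Build F V span_pred span_submod_closed).
End Span.

Definition quotmod_map (F : fieldType) (V : lmodType F) (S : submodClosed V)
  (f : endo V) : quotmod S -> quotmod S :=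
  quotmod_lift (fun v => quotmod_pi S (f v)).

Lemma quotmod_mapE (F : fieldType) (V : lmodType F) (S : submodClosed V)
    (f : endo V) (v : V) : (forall u, u \in S -> f u \in S) ->
  quotmod_map f (quotmod_pi S v) = quotmod_pi S (f v).
Proof.
move=> fS; apply: (quotmod_liftE (f := fun v => quotmod_pi S (f v))) => u w uw.
by apply/quotmod_piP; rewrite -(raddfB (f : {linear V -> V})) fS.
Qed.

Section Tensor.
Variables (F : fieldType) (V V' : lmodType F).
Local Notation free := {malg F[(V * V')%type]}.
Local Notation b v v' := (<< (v, v') >> : free).

Inductive bilinear_relator : free -> Prop :=
| bilinear_Dl u v v' : bilinear_relator (b (u + v) v' - b u v' - b v v')
| bilinear_Dr v u' v' : bilinear_relator (b v (u' + v') - b v u' - b v v')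
| bilinear_Zl c v v' : bilinear_relator (b (c *: v) v' - c *: b v v')
| bilinear_Zr c v v' : bilinear_relator (b v (c *: v') - c *: b v v').

Definition tensor : Type := quotmod (span bilinear_relator).
HB.instance Definition _ := GRing.Lmodule.on tensor.

Definition tens (v : V) (v' : V') : tensor :=
  quotmod_pi (span bilinear_relator) (b v v').
End Tensor.

Definition tensor_lift (F : fieldType) (V V' W : lmodType F)
    (h : V -> V' -> W) : tensor V V' -> W :=
  quotmod_lift (free_lift (fun p : (V * V')%type => h p.1 p.2)).

Lemma quotmod_lift_span (F : fieldType) (V W : lmodType F) (gens : V -> Prop)
    (f : {linear V -> W}) : (forall v, gens v -> f v = 0) ->
  forall v, quotmod_lift f (quotmod_pi (span gens) v) = f v.
Proof.
move=> f0 v; apply: quotmod_liftE => u w /asboolP uw.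
apply/eqP; rewrite -subr_eq0 -raddfB /=; apply/eqP.
elim: uw => [|||c x _ fx]; first exact: f0; first exact: raddf0.
  by move=> x y _ fx _ fy; rewrite raddfD /= fx fy addr0.
by rewrite linearZ /= fx scaler0.
Qed.

Section TensorLift.
Variables (F : fieldType) (V V' W : lmodType F) (h : V -> V' -> W).
Hypothesis hl : forall v', linear (h^~ v').
Hypothesis hr : forall v, linear (h v).

Fact free_lift_bilinear x : bilinear_relator x ->
  free_lift (fun p : (V * V')%type => h p.1 p.2) x = 0.
Proof.
have hDl u v v' : h (u + v) v' = h u v' + h v v'.
  by rewrite -[u in LHS]scale1r hl scale1r.
have hDr v u' v' : h v (u' + v') = h v u' + h v v'.
  by rewrite -[u' in LHS]scale1r hr scale1r.
have h0l v' : h 0 v' = 0 by apply: (@addIr _ (h 0 v')); rewrite -hDl !add0r.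
have h0r v : h v 0 = 0 by apply: (@addIr _ (h v 0)); rewrite -hDr !add0r.
have hZl c v v' : h (c *: v) v' = c *: h v v'.
  by rewrite -[_ *: v]addr0 hl h0l addr0.
have hZr c v v' : h v (c *: v') = c *: h v v'.
  by rewrite -[_ *: v']addr0 hr h0r addr0.
set f := free_lift _.
have fU v v' : f << (v, v') >> = h v v' by rewrite /f free_liftU scale1r.
have fB y z : f (y - z) = f y - f z by rewrite /f linearB.
have fZ c y : f (c *: y) = c *: f y by rewrite /f linearZ.
case=> [u v v'|v u' v'|c v v'|c v v']; rewrite !fB ?fZ !fU.
- by rewrite hDl addrAC addrK subrr.
- by rewrite hDr addrAC addrK subrr.
- by rewrite hZl subrr.
- by rewrite hZr subrr.
Qed.

Lemma tensor_lift_pi x :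
  tensor_lift h (quotmod_pi (span (@bilinear_relator F V V')) x) =
  free_lift (fun p : (V * V')%type => h p.1 p.2) x.
Proof. by apply: quotmod_lift_span; apply: free_lift_bilinear. Qed.

Lemma tensor_liftE v v' : tensor_lift h (tens v v') = h v v'.
Proof. by rewrite /tens tensor_lift_pi free_liftU scale1r. Qed.

Lemma tensor_lift_linear : linear (tensor_lift h).
Proof.
move=> c; elim/quotmod_ind=> x; elim/quotmod_ind=> y.
by rewrite -linearP !tensor_lift_pi linearP.
Qed.
End TensorLift.

Section TensorMap.
Variables (F : fieldType) (V V' : lmodType F).
Local Notation rel := (span (@bilinear_relator F V V')).

Fact tens_rel x : bilinear_relator x -> quotmod_pi rel x = 0.
Proof.
move=> xR; rewrite -[RHS](raddf0 (quotmod_pi rel)); apply/quotmod_piP.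
by rewrite subr0; apply/asboolP/in_span_gen.
Qed.

Lemma tens_linearl (v' : V') : linear (fun v : V => tens v v').
Proof.
move=> c u v; apply/eqP; rewrite -subr_eq0 opprD addrA; apply/eqP.
have /= := tens_rel (bilinear_Dl (c *: u) v v').
have /= := tens_rel (bilinear_Zl c u v').
rewrite !(raddfB (quotmod_pi rel)) /= (linearZ_LR (quotmod_pi rel)).
by move/eqP; rewrite subr_eq0 => /eqP <-.
Qed.

Lemma tens_linearr (v : V) : linear (fun v' : V' => tens v v').
Proof.
move=> c u' v'; apply/eqP; rewrite -subr_eq0 opprD addrA; apply/eqP.
have /= := tens_rel (bilinear_Dr v (c *: u') v').
have /= := tens_rel (bilinear_Zr c v u').
rewrite !(raddfB (quotmod_pi rel)) /= (linearZ_LR (quotmod_pi rel)).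
by move/eqP; rewrite subr_eq0 => /eqP <-.
Qed.
End TensorMap.

(* f (x) id *)
Definition tensor_mapl (F : fieldType) (V V' : lmodType F) (f : endo V) :
  tensor V V' -> tensor V V' := tensor_lift (fun v v' => tens (f v) v').

(* id (x) f *)
Definition tensor_mapr (F : fieldType) (V V' : lmodType F) (f : endo V') :
  tensor V V' -> tensor V V' := tensor_lift (fun v v' => tens v (f v')).

Lemma tensor_maplE (F : fieldType) (V V' : lmodType F) (f : endo V) (v : V)
  (v' : V') : tensor_mapl f (tens v v') = tens (f v) v'.
Proof.
apply: (tensor_liftE (h := fun v v' => tens (f v) v')) => [u'|u].
  by move=> c u w; rewrite endo_linear tens_linearl.
exact: tens_linearr.
Qed.

Lemma tensor_maprE (F : fieldType) (V V' : lmodType F) (f : endo V') (v : V)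
  (v' : V') : tensor_mapr f (tens v v') = tens v (f v').
Proof.
apply: (tensor_liftE (h := fun v v' => tens v (f v'))) => [u'|u].
  exact: tens_linearl.
by move=> c u' w'; rewrite endo_linear tens_linearr.
Qed.

Record glmod (F : fieldType) (m : nat) := GLMod {
  gl_space :> lmodType F;
  gl_act : {linear 'M[F]_m -> endo gl_space};
  gl_bracket : forall A B : 'M[F]_m,
    gl_act (A *m B - B *m A) = gl_act A * gl_act B - gl_act B * gl_act A
}.

Section IdealQuotient.
Variables (F : fieldType) (A : lalgType F) (gens : A -> Prop).

Inductive in_ideal : A -> Prop :=
| in_ideal_gen x : gens x -> in_ideal x
| in_ideal0 : in_ideal 0
| in_idealD x y : in_ideal x -> in_ideal y -> in_ideal (x + y)
| in_idealMl a x : in_ideal x -> in_ideal (a * x)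
| in_idealMr a x : in_ideal x -> in_ideal (x * a).

Definition ideal_pred (x : A) : bool := `[< in_ideal x >].

Fact ideal_submod_closed : subsemimod_closed ideal_pred.
Proof.
split=> [|c x /asboolP xI].
  split=> [|x y /asboolP xI /asboolP yI]; apply/asboolP; first exact: in_ideal0.
  exact: in_idealD.
by apply/asboolP; rewrite -mulr_algl; apply: in_idealMl.
Qed.

Definition ideal : submodClosed A :=
  HB.pack_for (submodClosed A) ideal_pred
    (GRing.isSubmodClosed.Build F A ideal_pred ideal_submod_closed).

Definition idealquot : Type := quotmod ideal.
HB.instance Definition _ := GRing.Lmodule.on idealquot.

Definition idealquot_mul (x y : idealquot) : idealquot :=
  quotmod_pi ideal (quotmod_repr x * quotmod_repr y).

Lemma idealquot_mulE x y :
  idealquot_mul (quotmod_pi ideal x) (quotmod_pi ideal y) =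
  quotmod_pi ideal (x * y).
Proof.
apply/quotmod_piP; set x' := quotmod_repr _; set y' := quotmod_repr _.
have -> : x' * y' - x * y = x' * (y' - y) + (x' - x) * y.
  by rewrite mulrBr mulrBl addrA subrK.
have /asboolP Ix : x' - x \in ideal by apply: quotmod_reprP.
have /asboolP Iy : y' - y \in ideal by apply: quotmod_reprP.
by apply/asboolP/in_idealD; [apply: in_idealMl | apply: in_idealMr].
Qed.

Fact idealquot_mulA : associative idealquot_mul.
Proof.
elim/quotmod_ind=> x; elim/quotmod_ind=> y; elim/quotmod_ind=> z.
by rewrite !idealquot_mulE mulrA.
Qed.
Fact idealquot_mul1 : left_id (quotmod_pi ideal 1) idealquot_mul.
Proof. by elim/quotmod_ind=> x; rewrite idealquot_mulE mul1r. Qed.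
Fact idealquot_mulr1 : right_id (quotmod_pi ideal 1) idealquot_mul.
Proof. by elim/quotmod_ind=> x; rewrite idealquot_mulE mulr1. Qed.
Fact idealquot_mulDl : left_distributive idealquot_mul +%R.
Proof.
elim/quotmod_ind=> x; elim/quotmod_ind=> y; elim/quotmod_ind=> z.
by rewrite -quotmod_piD !idealquot_mulE mulrDl quotmod_piD.
Qed.
Fact idealquot_mulDr : right_distributive idealquot_mul +%R.
Proof.
elim/quotmod_ind=> x; elim/quotmod_ind=> y; elim/quotmod_ind=> z.
by rewrite -quotmod_piD !idealquot_mulE mulrDr quotmod_piD.
Qed.

HB.instance Definition _ := GRing.Zmodule_isPzRing.Build idealquot
  idealquot_mulA idealquot_mul1 idealquot_mulr1 idealquot_mulDl idealquot_mulDr.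
End IdealQuotient.

Section Enveloping.
Variables (F : fieldType) (m : nat).
Local Notation free := {malg F[{fmonom ('I_m * 'I_m)%type}]}.
Local Notation E i j := (<< fmu (i, j) >> : free).

Inductive ugl_relator : free -> Prop :=
| ugl_bracket i j k l : ugl_relator
    (E i j * E k l - E k l * E i j
     - ((j == k)%:R *: E i l - (l == i)%:R *: E k j)).

(* U(gl_m): free algebra on the E_ij modulo the two-sided ideal generated by
   [E_ij, E_kl] - (delta_jk E_il - delta_li E_kj). *)
Definition ugl : Type := idealquot ugl_relator.
HB.instance Definition _ := GRing.PzRing.on ugl.
HB.instance Definition _ := GRing.Lmodule.on ugl.

Definition ugl_gen (i j : 'I_m) : ugl := quotmod_pi (ideal ugl_relator) (E i j).

Definition ugl_mx : 'M[ugl]_m := \matrix_(i, j) ugl_gen i j.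

(* q((E_ij)), with powers taken in the ring of m x m matrices over U(gl_m). *)
Definition ugl_horner (q : {poly F}) : 'M[ugl]_m :=
  \sum_(r < size q) (q`_r *: (1 : ugl)) *: ugl_mx ^+ r.

Definition word_act (V : glmod F m) (w : {fmonom ('I_m * 'I_m)%type}) :
  endo V := \prod_(p <- (w : seq _)) gl_act V (delta_mx p.1 p.2).

(* The action of U(gl_m) on V: the algebra morphism extending gl_act V, see
   ugl_act_gen and ugl_act_monoid_morphism. *)
Definition ugl_act (V : glmod F m) : ugl -> endo V :=
  quotmod_lift (free_lift (word_act V)).

Section UglAct.
Variable V : glmod F m.
Local Notation ev := (free_lift (word_act V)).

Lemma word_act1 : ev 1 = 1.
Proof. by rewrite free_liftU scale1r /word_act fm1 big_nil. Qed.

Lemma word_actU i j : ev (E i j) = gl_act V (delta_mx i j).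
Proof. by rewrite free_liftU scale1r /word_act fmU big_seq1. Qed.

Lemma word_actM x y : ev (x * y) = ev x * ev y.
Proof.
rewrite malgME raddf_sum [ev x in RHS]/free_lift mulr_suml.
apply: eq_bigr => w1 _; rewrite raddf_sum [ev y in RHS]/free_lift mulr_sumr.
apply: eq_bigr => w2 _; rewrite /= free_liftU /word_act fmM big_cat /=.
by rewrite endo_scaleAl endo_scaleAr scalerA.
Qed.

Lemma word_act_ideal x : in_ideal ugl_relator x -> ev x = 0.
Proof.
have evBB y z s t y' z' s' t' : ev y = y' -> ev z = z' -> ev s = s' ->
    ev t = t' -> ev (y - z - (s - t)) = y' - z' - (s' - t').
  by move=> <- <- <- <-; rewrite !(linearB (free_lift (word_act V))).
have evZE c i j : ev (c *: E i j) = c *: gl_act V (delta_mx i j).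
  by rewrite -word_actU; apply: (linearZ_LR (free_lift (word_act V))).
have evEE i j a b :
    ev (E i j * E a b) = gl_act V (delta_mx i j) * gl_act V (delta_mx a b).
  by rewrite word_actM; congr (_ * _); apply: word_actU.
elim=> [y [i j a b]|| y z _ ey _ ez| a y _ ey | a y _ ey].
- rewrite (evBB _ _ _ _ _ _ _ _ (evEE i j a b) (evEE a b i j)
    (evZE (j == a)%:R i b) (evZE (b == i)%:R a j)).
  rewrite -gl_bracket !mul_delta_mx_cond -!scaler_nat (linearB (gl_act V)).
  by rewrite !(linearZ_LR (gl_act V)) subrr.
- by rewrite raddf0.
- by rewrite raddfD /= ey ez addr0.
- by rewrite word_actM ey mulr0.
- by rewrite word_actM ey mul0r.
Qed.

Lemma ugl_actE x : ugl_act V (quotmod_pi (ideal ugl_relator) x) = ev x.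
Proof.
apply: quotmod_liftE => u w /asboolP /word_act_ideal euw.
apply/eqP; rewrite -subr_eq0 -(linearB (free_lift (word_act V))).
exact/eqP.
Qed.

Lemma ugl_act_gen i j : ugl_act V (ugl_gen i j) = gl_act V (delta_mx i j).
Proof. by rewrite ugl_actE word_actU. Qed.

Fact ugl_act_linear : linear (ugl_act V).
Proof.
move=> c; elim/quotmod_ind=> x; elim/quotmod_ind=> y.
by rewrite -linearP !ugl_actE linearP.
Qed.

Fact ugl_act_monoid_morphism : monoid_morphism (ugl_act V).
Proof.
split; first by rewrite ugl_actE word_act1.
elim/quotmod_ind=> x; elim/quotmod_ind=> y.
by rewrite [_ * _ in LHS]idealquot_mulE !ugl_actE word_actM.
Qed.

HB.instance Definition _ :=
  GRing.isLinear.Build F ugl (endo V) *:%R (ugl_act V) ugl_act_linear.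
HB.instance Definition _ :=
  GRing.isMonoidMorphism.Build ugl (endo V) (ugl_act V) ugl_act_monoid_morphism.
End UglAct.

Definition annihilates (V : glmod F m) (q : {poly F}) : Prop :=
  forall (i j : 'I_m) (v : V), ugl_act V (ugl_horner q i j) v = 0.

Definition is_minpoly (V : glmod F m) (q : {poly F}) : Prop :=
  [/\ q \is monic, annihilates V q &
      forall p : {poly F}, p \is monic -> annihilates V p ->
        (size q <= size p)%N].
End Enveloping.

Section Weyl.
Variables (F : fieldType) (k n : nat).
Local Notation P := (mpoly.mpoly (k * n) F).

(* Polynomials on k x n matrices: the coordinate (a, i) is the variable of index
   mxvec_index a i. *)
Fact mulop_subproof (p : P) : linear (fun u : P => p * u).
Proof. by move=> c u v; rewrite mulrDr scalerAr. Qed.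

Definition mulop (p : P) : endo P := mk_endo (mulop_subproof p).

Definition derop (i : 'I_(k * n)) : endo P :=
  mk_endo (mpoly.mderiv_is_linear i).

(* The subalgebra of endo {mpoly F[k * n]} generated by the multiplications by
   polynomials and the partial derivatives. *)
Inductive is_diffop : endo P -> Prop :=
| is_diffop_mulop p : is_diffop (mulop p)
| is_diffop_derop i : is_diffop (derop i)
| is_diffopD f g : is_diffop f -> is_diffop g -> is_diffop (f + g)
| is_diffopM f g : is_diffop f -> is_diffop g -> is_diffop (f * g).

Definition diffop_pred (f : endo P) : bool := `[< is_diffop f >].

Lemma is_diffopZ c f : is_diffop f -> is_diffop (c *: f).
Proof.
move=> fW; suff -> : c *: f = mulop (c *: 1) * f.
  by apply: is_diffopM => //; apply: is_diffop_mulop.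
by apply: endoP => u; rewrite [RHS]mulr_algl.
Qed.

Fact diffop_subring_closed : subring_closed diffop_pred.
Proof.
split=> [|f g /asboolP fW /asboolP gW|f g /asboolP fW /asboolP gW]; apply/asboolP.
- suff -> : 1 = mulop 1 by apply: is_diffop_mulop.
  by apply: endoP => u; rewrite [RHS]mul1r.
- by rewrite -scaleN1r; apply: is_diffopD => //; apply: is_diffopZ.
- exact: is_diffopM.
Qed.

Fact diffop_submod_closed : subsemimod_closed diffop_pred.
Proof.
split=> [|c f /asboolP fW]; last exact/asboolP/is_diffopZ.
exact: (GRing.subring_closedB diffop_subring_closed).
Qed.

Record weyl := Weyl { weyl_op : endo P; weyl_opP : diffop_pred weyl_op }.

HB.instance Definition _ := [isSub for weyl_op].
HB.instance Definition _ := [Choice of weyl by <:].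
HB.instance Definition _ := GRing.SubChoice_isSubPzRing.Build
  (endo P) diffop_pred weyl diffop_subring_closed.
HB.instance Definition _ := GRing.SubZmodule_isSubLmodule.Build
  F (endo P) diffop_pred weyl diffop_submod_closed.

Fact weyl_x_subproof a i : diffop_pred
  (mulop (mpoly.mpolyX F (mpoly.mnm1 (@mxvec_index k n a i)))).
Proof. exact/asboolP/is_diffop_mulop. Qed.

Fact weyl_d_subproof a i : diffop_pred (derop (@mxvec_index k n a i)).
Proof. exact/asboolP/is_diffop_derop. Qed.

Definition weyl_x (a : 'I_k) (i : 'I_n) : weyl := Weyl (weyl_x_subproof a i).
Definition weyl_d (a : 'I_k) (i : 'I_n) : weyl := Weyl (weyl_d_subproof a i).

Definition weyl_X : 'M[weyl]_(k, n) := \matrix_(a, i) weyl_x a i.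
Definition weyl_D : 'M[weyl]_(k, n) := \matrix_(a, i) weyl_d a i.

Definition howe_L (M : 'M[F]_k) : weyl :=
  \sum_a \sum_b M a b *: (weyl_X *m weyl_D^T) a b.

Definition howe_R (M : 'M[F]_n) : weyl :=
  \sum_i \sum_j M i j *: (weyl_X^T *m weyl_D) i j.

Lemma weyl_xxC a i b j : weyl_x a i * weyl_x b j = weyl_x b j * weyl_x a i.
Proof. by apply/val_inj/endoP => u; apply: mulrCA. Qed.

Lemma weyl_ddC a i b j : weyl_d a i * weyl_d b j = weyl_d b j * weyl_d a i.
Proof. by apply/val_inj/endoP => u; apply: mpoly.mderiv_comm. Qed.

Lemma weyl_dx a i b j : weyl_d a i * weyl_x b j =
  weyl_x b j * weyl_d a i + ((a == b) && (i == j))%:R.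
Proof.
have -> : (a == b) && (i == j) = (mxvec_index b j == mxvec_index a i).
  rewrite eq_sym; apply/andP/eqP => [[/eqP-> /eqP->] // |].
  by rewrite /mxvec_index => /cast_ord_inj/enum_rank_inj [-> ->].
have valn c : weyl_op (c%:R : weyl) = c%:R by elim: c => // c IHc; rewrite !mulrS -IHc.
have endon c (u : P) : (c%:R : endo P) u = c%:R * u.
  by elim: c => [|c IHc]; rewrite ?mul0r // !mulrS mulrDl mul1r -IHc.
apply/val_inj/endoP => u.
rewrite [LHS]mpoly.mderivM mpoly.mderivX mpoly.mnm1E addrC.
congr (_ + _); rewrite [RHS](congr1 (fun f : endo P => f u) (valn _)) endon.
case: eqP => [->|_]; last by rewrite scale0r !mul0r.
rewrite scale1r; congr (_ * u); rewrite -[RHS]mpoly.mpolyX0; congr (mpoly.mpolyX _ _).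
by apply/mpoly.mnmP => l; rewrite mpoly.mnmBE subnn mpoly.mnm0E.
Qed.

Lemma howe_R_delta i j :
  howe_R (delta_mx i j) = \sum_a weyl_x a i * weyl_d a j.
Proof.
rewrite /howe_R (bigD1 i) //= [X in _ + X]big1 ?addr0 => [|r ri].
  rewrite (bigD1 j) //= [X in _ + X]big1 ?addr0 => [|s sj].
    by rewrite mxE !eqxx scale1r mxE; apply: eq_bigr => a _; rewrite !mxE.
  by rewrite mxE (negPf sj) andbF scale0r.
by rewrite big1 // => s _; rewrite mxE (negPf ri) scale0r.
Qed.

Lemma howe_L_delta a b :
  howe_L (delta_mx a b) = \sum_i weyl_x a i * weyl_d b i.
Proof.
rewrite /howe_L (bigD1 a) //= [X in _ + X]big1 ?addr0 => [|r ra].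
  rewrite (bigD1 b) //= [X in _ + X]big1 ?addr0 => [|s sb].
    by rewrite mxE !eqxx scale1r mxE; apply: eq_bigr => i _; rewrite !mxE.
  by rewrite mxE (negPf sb) andbF scale0r.
by rewrite big1 // => s _; rewrite mxE (negPf ra) scale0r.
Qed.

Fact weyl_natZ (b : bool) (w : weyl) : b%:R * w = b%:R *: w.
Proof. by case: b; rewrite ?mul1r ?scale1r ?mul0r ?scale0r. Qed.

Lemma weyl_xdxd a i b j c r d s :
  weyl_x a i * weyl_d b j * (weyl_x c r * weyl_d d s) =
  weyl_x a i * weyl_x c r * (weyl_d b j * weyl_d d s)
  + ((b == c) && (j == r))%:R * (weyl_x a i * weyl_d d s).
Proof.
rewrite mulrA -[_ * _ * weyl_x c r]mulrA weyl_dx mulrDr mulrDl !mulrA.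
by congr (_ + _); case: (_ && _); rewrite ?mulr0 ?mul0r ?mulr1 ?mul1r.
Qed.

Lemma howe_R_bracket i j r s :
  howe_R (delta_mx i j) * howe_R (delta_mx r s)
  - howe_R (delta_mx r s) * howe_R (delta_mx i j)
  = (j == r)%:R *: howe_R (delta_mx i s) - (s == i)%:R *: howe_R (delta_mx r j).
Proof.
have EE i' j' r' s' : howe_R (delta_mx i' j') * howe_R (delta_mx r' s') =
    \sum_a \sum_b weyl_x a i' * weyl_x b r' * (weyl_d a j' * weyl_d b s')
    + (j' == r')%:R * howe_R (delta_mx i' s').
  rewrite !howe_R_delta mulr_suml mulr_sumr -big_split /=; apply: eq_bigr => a _.
  rewrite mulr_sumr (eq_bigr _ (fun b _ => weyl_xdxd _ _ _ _ _ _ _ _)) big_split /=.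
  congr (_ + _); rewrite (bigD1 a) //= eqxx big1 ?addr0 // => b ba.
  by rewrite eq_sym (negPf ba) mul0r.
rewrite !EE !weyl_natZ [X in _ - (X + _)]exchange_big /= opprD addrACA.
rewrite (_ : _ - _ = 0) ?add0r //; apply/eqP; rewrite subr_eq0; apply/eqP.
apply: eq_bigr => a _; apply: eq_bigr => b _.
by rewrite weyl_xxC weyl_ddC.
Qed.

Lemma howe_L_bracket a b c d :
  howe_L (delta_mx a b) * howe_L (delta_mx c d)
  - howe_L (delta_mx c d) * howe_L (delta_mx a b)
  = (b == c)%:R *: howe_L (delta_mx a d) - (d == a)%:R *: howe_L (delta_mx c b).
Proof.
have EE a' b' c' d' : howe_L (delta_mx a' b') * howe_L (delta_mx c' d') =
    \sum_i \sum_j weyl_x a' i * weyl_x c' j * (weyl_d b' i * weyl_d d' j)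
    + (b' == c')%:R * howe_L (delta_mx a' d').
  rewrite !howe_L_delta mulr_suml mulr_sumr -big_split /=; apply: eq_bigr => i _.
  rewrite mulr_sumr (eq_bigr _ (fun j _ => weyl_xdxd _ _ _ _ _ _ _ _)) big_split /=.
  congr (_ + _); rewrite (bigD1 i) //= eqxx andbT big1 ?addr0 // => j ji.
  by rewrite [i == j]eq_sym (negPf ji) andbF mul0r.
rewrite !EE !weyl_natZ [X in _ - (X + _)]exchange_big /= opprD addrACA.
rewrite (_ : _ - _ = 0) ?add0r //; apply/eqP; rewrite subr_eq0; apply/eqP.
apply: eq_bigr => i _; apply: eq_bigr => j _.
by rewrite weyl_xxC weyl_ddC.
Qed.

Fact howe_R_linear : linear howe_R.
Proof.
move=> c M N; rewrite /howe_R scaler_sumr -big_split; apply: eq_bigr => i _.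
rewrite scaler_sumr -big_split; apply: eq_bigr => j _.
by rewrite !mxE scalerDl scalerA.
Qed.

Fact howe_L_linear : linear howe_L.
Proof.
move=> c M N; rewrite /howe_L scaler_sumr -big_split; apply: eq_bigr => i _.
rewrite scaler_sumr -big_split; apply: eq_bigr => j _.
by rewrite !mxE scalerDl scalerA.
Qed.

HB.instance Definition _ :=
  GRing.isLinear.Build F 'M[F]_n weyl *:%R howe_R howe_R_linear.
HB.instance Definition _ :=
  GRing.isLinear.Build F 'M[F]_k weyl *:%R howe_L howe_L_linear.

(* A unital module over weyl, given by an F-algebra morphism to the
   endomorphisms of its underlying vector space. *)
Record wmod := WMod {
  w_space :> lmodType F;
  w_act : {rmorphism weyl -> endo w_space};
  w_scale : scalable w_act
}.
End Weyl.

Section PullBack.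
Variables (F : fieldType) (m : nat).

Fact mx_linear0 (W : lmodType F) (f : 'M[F]_m -> W) : linear f ->
  (forall i j, f (delta_mx i j) = 0) -> forall M, f M = 0.
Proof.
move=> fl f0 M.
pose g : {linear 'M[F]_m -> W} := HB.pack f (GRing.isLinear.Build F _ W *:%R f fl).
have gZ c N : g (c *: N) = c *: f N by apply: (linearZ_LR g).
rewrite -[f M]/(g M) [M]matrix_sum_delta linear_sum big1 // => i _.
rewrite linear_sum big1 // => j _.
by rewrite gZ f0 scaler0.
Qed.

Fact gl_bracket_delta (A : lmodType F) (rho : {linear 'M[F]_m -> endo A}) :
  (forall i j r s : 'I_m,
     rho (delta_mx i j) * rho (delta_mx r s)
     - rho (delta_mx r s) * rho (delta_mx i j)
     = (j == r)%:R *: rho (delta_mx i s) - (s == i)%:R *: rho (delta_mx r j)) ->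
  forall M N : 'M[F]_m,
    rho (M *m N - N *m M) = rho M * rho N - rho N * rho M.
Proof.
move=> Hd.
pose B (M N : 'M[F]_m) := rho (M *m N - N *m M) - (rho M * rho N - rho N * rho M).
have BC M N : B M N = - B N M.
  by rewrite /B -[M *m N - _]opprB raddfN -[rho M * _ - _]opprB -opprD.
have Bl N : linear (B^~ N).
  move=> c M M'; rewrite /B.
  have -> : (c *: M + M') *m N - N *m (c *: M + M') =
      c *: (M *m N - N *m M) + (M' *m N - N *m M').
    by rewrite mulmxDr mulmxDl -scalemxAr -scalemxAl opprD addrACA -scalerBr.
  have -> : rho (c *: M + M') * rho N - rho N * rho (c *: M + M') =
      c *: (rho M * rho N - rho N * rho M) + (rho M' * rho N - rho N * rho M').
    rewrite linearP mulrDr mulrDl endo_scaleAr endo_scaleAl opprD addrACA.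
    by rewrite -scalerBr.
  by rewrite linearP opprD addrACA -scalerBr.
have Bd i j r s : B (delta_mx i j) (delta_mx r s) = 0.
  rewrite /B Hd !mul_delta_mx_cond -!scaler_nat (linearB rho).
  by rewrite !(linearZ_LR rho) subrr.
have B0 M i j : B M (delta_mx i j) = 0.
  by apply: (mx_linear0 (f := B^~ _)) => [|r s]; [apply: Bl | apply: Bd].
move=> M N; apply/eqP; rewrite -subr_eq0 -[_ - _]/(B M N) BC oppr_eq0; apply/eqP.
apply: (mx_linear0 (f := B^~ _)) => [|r s]; first exact: Bl.
by rewrite BC B0 oppr0.
Qed.
End PullBack.

Section WeylPullBack.
Variables (F : fieldType) (k n : nat) (A : wmod F k n).

Definition wmod_R (M : 'M[F]_n) : endo A := w_act A (howe_R k M).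
Definition wmod_L (N : 'M[F]_k) : endo A := w_act A (howe_L n N).

Fact wmod_R_linear : linear wmod_R.
Proof. by move=> c M N; rewrite /wmod_R linearP rmorphD /= w_scale. Qed.
Fact wmod_L_linear : linear wmod_L.
Proof. by move=> c M N; rewrite /wmod_L linearP rmorphD /= w_scale. Qed.

HB.instance Definition _ :=
  GRing.isLinear.Build F 'M[F]_n (endo A) *:%R wmod_R wmod_R_linear.
HB.instance Definition _ :=
  GRing.isLinear.Build F 'M[F]_k (endo A) *:%R wmod_L wmod_L_linear.

Fact wmod_R_bracket (M N : 'M[F]_n) :
  wmod_R (M *m N - N *m M) = wmod_R M * wmod_R N - wmod_R N * wmod_R M.
Proof.
apply: gl_bracket_delta => i j r s; rewrite /= /wmod_R -!rmorphM -rmorphB /=.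
by rewrite howe_R_bracket -!w_scale -rmorphB.
Qed.

Fact wmod_L_bracket (M N : 'M[F]_k) :
  wmod_L (M *m N - N *m M) = wmod_L M * wmod_L N - wmod_L N * wmod_L M.
Proof.
apply: gl_bracket_delta => i j r s; rewrite /= /wmod_L -!rmorphM -rmorphB /=.
by rewrite howe_L_bracket -!w_scale -rmorphB.
Qed.

Definition pullback_R : glmod F n := GLMod wmod_R_bracket.
Definition pullback_L : glmod F k := GLMod wmod_L_bracket.
End WeylPullBack.

(* A/A0 and V (x) V' are compared through one linear bijection that intertwines
   the actions of gl_n and those of gl_k; gl_n acts on V (x) V' through V and
   gl_k through V'. *)
Definition howe_dual (F : fieldType) (n k : nat) (V : glmod F n)
    (V' : glmod F k) : Prop :=
  [/\ exists v : V, v != 0,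
      exists v' : V', v' != 0 &
      exists (A : wmod F k n) (A0 : submodClosed A),
        [/\ exists a : A, a != 0,
            forall (M : 'M[F]_n) a, a \in A0 ->
              gl_act (pullback_R A) M a \in A0,
            forall (N : 'M[F]_k) a, a \in A0 ->
              gl_act (pullback_L A) N a \in A0 &
            exists phi : {linear quotmod A0 -> tensor V V'},
              [/\ bijective phi,
                  forall (M : 'M[F]_n) x,
                    phi (quotmod_map (gl_act (pullback_R A) M) x) =
                    tensor_mapl (gl_act V M) (phi x) &
                  forall (N : 'M[F]_k) x,
                    phi (quotmod_map (gl_act (pullback_L A) N) x) =
                    tensor_mapr (gl_act V' N) (phi x)]]].

(* Main.v *)
(** Write L = X D^t and R = X^t D. Since D X^t = L^t + n, and since the
    columns of Z = (L + n - k)^m X satisfy [L_ab, Z_ci] = delta_bc Z_ai,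
    induction on m gives R^(m+1) = ((L + n - k)^m X)^t D. Hence, for p(u) =
    q'(u + k - n), the entries of R p(R) are the sums of q'(L)_ba x_ai d_bj
    over a and b. As q'(L)_ba kills V (x) V', it maps A into A0, so u p(u)
    annihilates A/A0 = V (x) V' as a gl_n-module, and therefore V because V'
    is nonzero. The other divisibility is the same statement for X^t and
    D^t. *)

From HB Require Import structures.
Require Import Defs.
From mathcomp Require Import all_boot all_order all_algebra reals complex.
From mathcomp Require Import boolp classical_sets monalg.

Set Implicit Arguments.
Unset Strict Implicit.
Unset Printing Implicit Defensive.

Import GRing.Theory.
Local Open Scope ring_scope.

(** * Commutation relations and powers of the two Euler matrices *)

Section WeylPowers.
Variables (W : pzRingType) (k n : nat) (X D : 'M[W]_(k, n)).
Hypothesis XXC : forall a i b j, X a i * X b j = X b j * X a i.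
Hypothesis DDC : forall a i b j, D a i * D b j = D b j * D a i.
Hypothesis DXC : forall a i b j,
  D a i * X b j = X b j * D a i + ((a == b) && (i == j))%:R.

Local Notation L := (X *m D^T).

Lemma euler_mxE a b : L a b = \sum_i X a i * D b i.
Proof. by rewrite mxE; apply: eq_bigr => i _; rewrite mxE. Qed.

Lemma euler_mx_X a b c i :
  L a b * X c i = X c i * L a b + (b == c)%:R * X a i.
Proof.
rewrite euler_mxE mulr_suml mulr_sumr (eq_bigr (fun j =>
  X c i * (X a j * D b j) + ((b == c) && (j == i))%:R * X a j)); last first.
  move=> j _; rewrite -mulrA DXC mulrDr !mulrA [X a j * X c i]XXC.
  by congr (_ + _); rewrite -commr_nat.
rewrite big_split /=; congr (_ + _).
rewrite (bigD1 i) //= eqxx andbT big1 ?addr0 // => j /negPf ->.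
by rewrite andbF mul0r.
Qed.

Lemma D_euler_mx a b c i :
  D c i * L a b = L a b * D c i + (c == a)%:R * D b i.
Proof.
rewrite euler_mxE mulr_suml mulr_sumr (eq_bigr (fun j =>
  X a j * D b j * D c i + ((c == a) && (i == j))%:R * D b j)); last first.
  by move=> j _; rewrite mulrA DXC mulrDl -!mulrA [D c i * D b j]DDC.
rewrite big_split /=; congr (_ + _).
rewrite (bigD1 i) //= eqxx andbT big1 ?addr0 // => j.
by rewrite eq_sym => /negPf ->; rewrite andbF mul0r.
Qed.

(** The commutation relations of [gl_k], with the negative terms moved across the equation so that
    both sides can be compared summand by summand without subtraction. *)
Lemma euler_mx_bracket a b c d :
  L a b * L c d + (a == d)%:R * L c b = L c d * L a b + (b == c)%:R * L a d.
Proof.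
rewrite [L c d]euler_mxE [L c b]euler_mxE [L a d]euler_mxE.
rewrite !mulr_sumr mulr_suml -!big_split /=; apply: eq_bigr => i _.
rewrite mulrA euler_mx_X mulrDl -mulrA.
rewrite -[X c i * D d i * _]mulrA [in RHS]D_euler_mx mulrDr -!addrA.
congr (_ + _); rewrite addrC [d == a]eq_sym !mulrA; congr (_ + _).
by rewrite commr_nat.
Qed.

(* The columns of [Z] span copies of the natural module under the adjoint action
   of the entries of [L], as the columns of [X] do. *)
Definition euler_covariant (Z : 'M[W]_(k, n)) :=
  forall a b c i, L a b * Z c i = Z c i * L a b + (b == c)%:R * Z a i.

(** Moving [L a b] past [L c d] and then past [Z d i] produces the term [L c b * Z a i] twice with
    opposite signs; what survives is the covariance of the product. *)
Lemma euler_covariant_mul Z :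
  euler_covariant Z -> euler_covariant (L *m Z).
Proof.
move=> ZP a b c i; rewrite [(L *m Z) c i]mxE [(L *m Z) a i]mxE.
rewrite mulr_sumr mulr_suml.
(* This is the left-hand correction of [euler_mx_bracket], summed against [Z d i]. *)
apply: (addIr (L c b * Z a i)).
have -> : L c b * Z a i = \sum_d (a == d)%:R * L c b * Z d i.
  rewrite (bigD1 a) //= eqxx mul1r big1 ?addr0 // => d.
  by rewrite eq_sym => /negPf ->; rewrite !mul0r.
rewrite -big_split /=.
rewrite (eq_bigr (fun d => L c d * Z d i * L a b +
    (b == d)%:R * (L c d * Z a i) + (b == c)%:R * (L a d * Z d i))); last first.
  move=> d _; rewrite mulrA -mulrDl euler_mx_bracket mulrDl -!mulrA ZP.
  by rewrite mulrDr !mulrA commr_nat.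
rewrite !big_split /= -mulr_sumr addrAC; congr (_ + _ + _).
rewrite (bigD1 b) //= eqxx mul1r big1 ?addr0 => [|d]; last first.
  by rewrite eq_sym => /negPf ->; rewrite mul0r.
rewrite (bigD1 a) //= eqxx mul1r big1 ?addr0 // => d.
by rewrite eq_sym => /negPf ->; rewrite !mul0r.
Qed.

Lemma euler_covariant_add (Z Z' : 'M[W]_(k, n)) :
  euler_covariant Z -> euler_covariant Z' -> euler_covariant (Z + Z').
Proof.
move=> ZP Z'P a b c i; rewrite [(Z + Z') c i]mxE [(Z + Z') a i]mxE.
by rewrite !mulrDr mulrDl ZP Z'P addrACA.
Qed.

Lemma euler_covariant_scale e (Z : 'M[W]_(k, n)) :
  (forall w, GRing.comm e w) -> euler_covariant Z -> euler_covariant (e *: Z).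
Proof.
move=> eC ZP a b c i; rewrite [(e *: Z) c i]mxE [(e *: Z) a i]mxE.
rewrite mulrA -eC -mulrA ZP mulrDr !mulrA.
by rewrite commr_nat.
Qed.

(** The [n] comes from reordering [D X^T], one unit per column; the [- k] from reordering the
    entries of [L] and of a covariant matrix, one unit per row. *)
Let e : W := n%:R - k%:R.

Let eC w : GRing.comm e w.
Proof. by apply: commr_sym; apply: commrB; apply: commr_nat. Qed.

Lemma euler_covariant_shift m : euler_covariant ((L + e%:M) ^+ m *m X).
Proof.
elim: m => [|m IHm]; first by rewrite mul1mx; apply: euler_mx_X.
rewrite exprS -mulmxA mulmxDl mul_scalar_mx.
apply: euler_covariant_add; first exact: euler_covariant_mul.
exact: euler_covariant_scale.
Qed.

Lemma dual_euler_mx_exp m :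
  (X^T *m D) ^+ m.+1 = ((L + e%:M) ^+ m *m X)^T *m D.
Proof.
elim: m => [|m IHm]; first by rewrite expr0 mul1mx expr1.
rewrite exprSr IHm [in RHS]exprS -[in RHS]mulmxA.
have := euler_covariant_shift m; set Z := _ *m X => ZP.
rewrite -[_ * _]/(_ *m _) mulmxA; congr (_ *m D).
(* It remains to see that [Z^T (D X^T)] is the transpose of [(L + e) Z]. *)
rewrite -mulmxA; apply/matrixP => i b; rewrite mulmxDl mul_scalar_mx.
rewrite mxE [RHS]mxE [RHS]mxE [X in _ = X + _]mxE [X in _ = _ + X]mxE.
under eq_bigr => a _.
  rewrite mxE [X in _ * X]mxE (eq_bigr (fun j =>
    X b j * D a j + (a == b)%:R)); last first.
    by move=> j _; rewrite mxE DXC eqxx andbT.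
  rewrite big_split /= -euler_mxE sumr_const card_ord mulrDr.
  over.
(* Covariance leaves one copy of [Z b i] for each of the [k] values of [a]; these cancel the [- k]
   in [e]. *)
under [in RHS]eq_bigr => a _ do rewrite ZP eqxx mul1r.
rewrite !big_split /= sumr_const card_ord -addrA mulrBl mulr_natl addrC.
rewrite [X in _ = _ + X]addrC mulr_natl subrK [RHS]addrC; congr (_ + _).
rewrite (bigD1 b) //= big1 => [|a /negPf ->]; last by rewrite mul0rn mulr0.
by rewrite eqxx addr0 mulrnAr mulr1.
Qed.
End WeylPowers.

Lemma endo_sumE (F : fieldType) (V : lmodType F) (m : nat)
    (f : 'I_m -> endo V) (v : V) : endo_fun (\sum_l f l) v = \sum_l f l v.
Proof. by elim/big_rec2: _ => // l g h _ <-. Qed.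

(** * Polynomials evaluated at matrices of endomorphisms *)

Section MatrixEvaluation.
Variables (F : fieldType) (V : lmodType F) (m : nat).
Implicit Types (p q : {poly F}) (M : 'M[endo V]_m) (c : F).

Local Notation I := (1 : endo V).

(** Matrices over [endo V] are scaled by elements of [endo V], so a coefficient [c] enters as the
    scalar endomorphism [c *: 1], as in [ugl_horner]. *)
Definition mxeval p M : 'M[endo V]_m :=
  \sum_(r < size p) (p`_r *: I) *: M ^+ r.

Lemma endo_scalarE c (f : endo V) : (c *: I) * f = c *: f.
Proof. by rewrite endo_scaleAl mul1r. Qed.

Lemma endo_scalarC c (f : endo V) : f * (c *: I) = (c *: I) * f.
Proof. by rewrite endo_scaleAr mulr1 endo_scalarE. Qed.

Lemma mxscalarAr s c (A : 'M[endo V]_(m, s)) M :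
  M *m ((c *: I) *: A) = (c *: I) *: (M *m A).
Proof.
apply/matrixP => i j; rewrite !mxE mulr_sumr; apply: eq_bigr => l _.
by rewrite mxE !mulrA endo_scalarC.
Qed.

Lemma mxevalEw N p M : (size p <= N)%N ->
  mxeval p M = \sum_(r < N) (p`_r *: I) *: M ^+ r.
Proof.
move=> le_pN; pose g r : 'M[endo V]_m := (p`_r *: I) *: M ^+ r.
rewrite /mxeval (big_ord_widen N g le_pN).
rewrite big_mkcond; apply: eq_bigr => r _; rewrite /g; case: ltnP => // le_pr.
by rewrite nth_default // scale0r scale0r.
Qed.

Lemma mxeval_entry p M i j u :
  mxeval p M i j u = \sum_(r < size p) p`_r *: (M ^+ r) i j u.
Proof.
rewrite /mxeval summxE; elim/big_rec2: _ => // r f g _ <-.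
by rewrite mxE endo_scalarE.
Qed.

Lemma mxevalD p q M : mxeval (p + q) M = mxeval p M + mxeval q M.
Proof.
rewrite (@mxevalEw _ p M (leq_maxl (size p) (size q))).
rewrite (@mxevalEw _ q M (leq_maxr (size p) (size q))).
rewrite (@mxevalEw (maxn (size p) (size q)) (p + q) M) ?size_polyD //.
by rewrite -big_split; apply: eq_bigr => r _; rewrite coefD !scalerDl.
Qed.

Lemma mxevalC c M : mxeval c%:P M = (c *: I)%:M.
Proof.
rewrite (@mxevalEw 1) ?size_polyC_leq1 // big_ord1 coefC /= expr0.
by rewrite -mul_scalar_mx mulmx1.
Qed.

Lemma mxevalMX p M : mxeval (p * 'X) M = mxeval p M * M.
Proof.
rewrite (@mxevalEw (size p).+1); last first.
  by rewrite (leq_trans (size_polyMleq _ _)) // size_polyX addn2.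
rewrite big_ord_recl coefMX /= !scale0r add0r mulr_suml.
apply: eq_bigr => r _; rewrite coefMX /= exprSr.
by rewrite -[RHS]/(_ *m _) -scalemxAl.
Qed.

Lemma mxevalZ c p M : mxeval (c *: p) M = (c *: I) *: mxeval p M.
Proof.
rewrite (@mxevalEw (size p)) ?size_scale_leq // scaler_sumr.
by apply: eq_bigr => r _; rewrite coefZ scalerA endo_scalarE scalerA.
Qed.

Lemma mxeval0 M : mxeval 0 M = 0.
Proof. by rewrite /mxeval size_poly0 big_ord0. Qed.

(** Although the entries do not commute, the coefficients act by scalars and commute with every
    matrix, so a Horner induction on [q] goes through. *)
Lemma mxevalM p q M : mxeval (p * q) M = mxeval p M * mxeval q M.
Proof.
elim/poly_ind: q => [|q c IHq]; first by rewrite mulr0 !mxeval0 mulr0.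
rewrite mulrDr mulrA !mxevalD !mxevalMX IHq mulrDr mulrA.
congr (_ + _); rewrite mulrC mul_polyC mxevalZ mxevalC.
rewrite -[RHS]/(_ *m _) -[(c *: I)%:M]mulmx1 mul_scalar_mx mxscalarAr.
by rewrite mulmx1.
Qed.

Lemma mxeval_comp_shift p c M :
  mxeval (p \Po ('X + c%:P)) M = mxeval p (M + (c *: I)%:M).
Proof.
elim/poly_ind: p => [|p d IHp]; first by rewrite comp_poly0 !mxeval0.
rewrite comp_poly_MXaddC mxevalD mxevalM IHp !mxevalD mxevalMX !mxevalC.
by rewrite -[X in mxeval X M]mul1r mxevalMX mxevalC scale1r mul1r.
Qed.
End MatrixEvaluation.

(* A maximal subspace avoiding [w], given by Zorn's lemma, is a hyperplane
   complementary to the line through [w]. *)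
Lemma exists_functional (F : fieldType) (V' : lmodType F) (w : V') : w != 0 ->
  exists l : V' -> F, l w = 1 /\ forall c u v, l (c *: u + v) = c * l u + l v.
Proof.
move=> w0.
pose P (A : set V') := ~ A w /\ forall c u v, A u -> A v -> A (c *: u + v).
have [F0 FP totF | A [[Aw Alin] Amax]] := @Zorn_bigcup V' P.
  split=> [[B FB Bw] | c u v [B FB Bu] [C FC Cv]].
    by have [nBw _] := FP _ FB.
  have [BC|CB] := totF _ _ FB FC.
    by exists C => //; apply: (FP _ FC).2 => //; apply: BC.
  by exists B => //; apply: (FP _ FB).2 => //; apply: CB.
(* [P] admits the empty set, the union of the empty chain, so [0] has to come from maximality:
   without it [A] would be empty, strictly inside the line-free set [{0}]. *)
have A0 : A 0.
  apply: contrapT => nA0.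
  apply: (Amax [set 0]%classic); last first.
    split=> [/= w0'|c u v /= -> ->]; first by rewrite w0' eqxx in w0.
    by rewrite scaler0 addr0.
  split; last by move/(_ 0 erefl).
  move=> x Ax; case: nA0; rewrite -(subrr x) addrC -scaleN1r.
  exact: Alin.
have AZ c u : A u -> A (c *: u).
  by move=> Au; rewrite -[_ *: _]addr0; apply: Alin.
have AD u v : A u -> A v -> A (u + v).
  by move=> Au Av; rewrite -[u]scale1r; apply: Alin.
have AB u v : A u -> A v -> A (u - v).
  by move=> Au Av; apply: AD => //; rewrite -scaleN1r; apply: AZ.
have ex v : exists c, A (v - c *: w).
  have [Av|nAv] := EM (A v); first by exists 0; rewrite scale0r subr0.
  pose B : set V' := [set x | exists d, A (x - d *: v)]%classic.
  have Blin c u x : B u -> B x -> B (c *: u + x).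
    move=> [d Bu] [e Bx]; exists (c * d + e).
    rewrite scalerDl opprD addrACA -scalerA -scalerBr.
    exact: Alin.
  have [[d Bw]|nBw] := EM (B w).
    have d0 : d != 0.
      by apply/eqP => d0; move: Bw; rewrite d0 scale0r subr0.
    exists d^-1; have -> : v - d^-1 *: w = - d^-1 *: (w - d *: v).
      rewrite scalerBr scalerA mulNr mulVf // scaleN1r opprK addrC.
      by rewrite scaleNr.
    exact: AZ.
  case: (Amax B) => //; split=> [x Ax|BA].
    by exists 0; rewrite scale0r subr0.
  by apply/nAv/BA; exists 1; rewrite scale1r subrr.
have uniqA v c d : A (v - c *: w) -> A (v - d *: w) -> c = d.
  move=> Ac Ad; apply/eqP; rewrite -subr_eq0; apply/negPn/negP => cd; apply: Aw.
  have : A ((c - d)^-1 *: ((v - d *: w) - (v - c *: w))) by apply/AZ/AB.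
  have -> : v - d *: w - (v - c *: w) = (c - d) *: w.
    by rewrite opprB addrC addrA subrK -scalerBl.
  by rewrite scalerA mulVf // scale1r.
pose l v := sval (cid (ex v)).
have lP v : A (v - l v *: w) by rewrite /l; case: (cid _).
(* As the coefficient along [w] is unique, the value at [w] and linearity both reduce to memberships
   in [A]. *)
exists l; split=> [|c u v]; apply: (uniqA _ _ _ (lP _)).
  by rewrite scale1r subrr.
rewrite scalerDl opprD addrACA -scalerA -scalerBr.
exact: Alin.
Qed.

(** * Endomorphisms acting on one factor of a tensor product *)

Section TensorFaithful.
Variables (F : fieldType) (V V' : lmodType F).

(** Contracting the second factor with a functional equal to 1 at [w] sends [tens v w] to [v]. *)
Lemma tens_eq0l (v : V) (w : V') : w != 0 -> tens v w = 0 -> v = 0.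
Proof.
move=> /exists_functional[l [lw llin]] vw0.
pose h (v : V) (v' : V') : V := l v' *: v.
have hl v' : linear (h^~ v').
  by move=> c x y; rewrite /h scalerDr !scalerA mulrC.
have hr x : linear (h x).
  by move=> c y z; rewrite /h llin scalerDl scalerA.
have := tensor_liftE hl hr v w; rewrite vw0 /h lw scale1r => <-.
have hlin := tensor_lift_linear hl hr.
by have := hlin (-1) 0 0; rewrite scaler0 addr0 scaleN1r addNr.
Qed.

Lemma tens_eq0r (v : V) (w : V') : v != 0 -> tens v w = 0 -> w = 0.
Proof.
move=> /exists_functional[l [lw llin]] vw0.
pose h (v : V) (v' : V') : V' := l v *: v'.
have hl v' : linear (h^~ v').
  by move=> c x y; rewrite /h llin scalerDl scalerA.
have hr x : linear (h x).
  by move=> c y z; rewrite /h scalerDr !scalerA mulrC.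
have := tensor_liftE hl hr v w; rewrite vw0 /h lw scale1r => <-.
have hlin := tensor_lift_linear hl hr.
by have := hlin (-1) 0 0; rewrite scaler0 addr0 scaleN1r addNr.
Qed.

(** Pure tensors span: every class is represented by a finite combination of basis pairs. *)
Lemma endo_tensorP (f g : endo (tensor V V')) :
  (forall v v', f (tens v v') = g (tens v v')) -> f = g.
Proof.
move=> fg; apply: endoP; elim/quotmod_ind => x; rewrite [x]monalgE.
rewrite !raddf_sum /endo_fun !raddf_sum; apply: eq_bigr => -[v v'] _.
set c := mcoeff (v, v') x.
have -> : mkmalgU (v, v') c = c *: << (v, v') >>.
  apply/malgP => l.
  by rewrite mcoeffZ !mcoeffU mulrnAr mulr1.
rewrite /= (linearZ_LR (quotmod_pi _)) (linearZ_LR (f : {linear _ -> _})).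
by rewrite (linearZ_LR (g : {linear _ -> _})); congr (_ *: _); apply: fg.
Qed.

Fact tensor_mapl_linear (f : endo V) : linear (@tensor_mapl F V V' f).
Proof.
apply: tensor_lift_linear => [v'|v]; last exact: tens_linearr.
by move=> c u w; rewrite endo_linear tens_linearl.
Qed.

Fact tensor_mapr_linear (f : endo V') : linear (@tensor_mapr F V V' f).
Proof.
apply: tensor_lift_linear => [v'|v]; first exact: tens_linearl.
by move=> c u w; rewrite endo_linear tens_linearr.
Qed.

Definition endo_tensorl (f : endo V) : endo (tensor V V') :=
  mk_endo (tensor_mapl_linear f).

Definition endo_tensorr (f : endo V') : endo (tensor V V') :=
  mk_endo (tensor_mapr_linear f).

Fact endo_tensorl_linear : linear endo_tensorl.
Proof.
move=> c f g; apply: endo_tensorP => v v'.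
rewrite [LHS]tensor_maplE [LHS]tens_linearl.
by congr (_ *: _ + _); rewrite -tensor_maplE.
Qed.

Fact endo_tensorr_linear : linear endo_tensorr.
Proof.
move=> c f g; apply: endo_tensorP => v v'.
rewrite [LHS]tensor_maprE [LHS]tens_linearr.
by congr (_ *: _ + _); rewrite -tensor_maprE.
Qed.

Fact endo_tensorl_monoid_morphism : monoid_morphism endo_tensorl.
Proof.
split=> [|f g]; apply: endo_tensorP => v v'; first exact: tensor_maplE.
rewrite [LHS]tensor_maplE.
by rewrite -[RHS]/(tensor_mapl f (tensor_mapl g (tens v v'))) !tensor_maplE.
Qed.

Fact endo_tensorr_monoid_morphism : monoid_morphism endo_tensorr.
Proof.
split=> [|f g]; apply: endo_tensorP => v v'; first exact: tensor_maprE.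
rewrite [LHS]tensor_maprE.
by rewrite -[RHS]/(tensor_mapr f (tensor_mapr g (tens v v'))) !tensor_maprE.
Qed.

HB.instance Definition _ := GRing.isLinear.Build F (endo V)
  (endo (tensor V V')) *:%R endo_tensorl endo_tensorl_linear.
HB.instance Definition _ := GRing.isMonoidMorphism.Build (endo V)
  (endo (tensor V V')) endo_tensorl endo_tensorl_monoid_morphism.
HB.instance Definition _ := GRing.isLinear.Build F (endo V')
  (endo (tensor V V')) *:%R endo_tensorr endo_tensorr_linear.
HB.instance Definition _ := GRing.isMonoidMorphism.Build (endo V')
  (endo (tensor V V')) endo_tensorr endo_tensorr_monoid_morphism.

(** This faithfulness lets an annihilation statement on the tensor product descend to [V]. *)
Lemma endo_tensorl_eq0 (w : V') (f : endo V) :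
  w != 0 -> endo_tensorl f = 0 -> f = 0.
Proof.
move=> w0 f0; apply: endoP => v; apply: (tens_eq0l w0).
by rewrite -tensor_maplE -[LHS]/(endo_tensorl f _) f0.
Qed.

Lemma endo_tensorr_eq0 (v : V) (f : endo V') :
  v != 0 -> endo_tensorr f = 0 -> f = 0.
Proof.
move=> v0 f0; apply: endoP => v'; apply: (tens_eq0r v0).
by rewrite -tensor_maprE -[LHS]/(endo_tensorr f _) f0.
Qed.
End TensorFaithful.

(** * Transport of evaluations along morphisms *)

Lemma mxeval_map (F : fieldType) (V W : lmodType F) (m : nat)
    (t : {rmorphism endo V -> endo W}) (p : {poly F}) (M : 'M[endo V]_m) :
  scalable t -> mxeval p (map_mx t M) = map_mx t (mxeval p M).
Proof.
move=> tZ; rewrite /mxeval raddf_sum; apply: eq_bigr => r _ /=.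
have -> : map_mx t M ^+ r = map_mx t (M ^+ r).
  elim: {r}(r : nat) => [|r IHr]; first by rewrite !expr0 map_mx1.
  by rewrite !exprS IHr -[RHS]/(map_mx t (_ *m _)) map_mxM.
by apply/matrixP => i j; rewrite !mxE rmorphM tZ rmorph1.
Qed.

(** A linear map [psi] need not induce a morphism of endomorphism rings, so the intertwining is
    carried pointwise from the entries to the powers, and then to polynomials. *)
Lemma mxeval_intertwine (F : fieldType) (V W : lmodType F) (m : nat)
    (psi : {linear V -> W}) (M : 'M[endo V]_m) (N : 'M[endo W]_m) :
  (forall i j u, psi (M i j u) = N i j (psi u)) ->
  forall p i j u, psi (mxeval p M i j u) = mxeval p N i j (psi u).
Proof.
move=> MN p i j u; rewrite !mxeval_entry linear_sum; apply: eq_bigr => r _.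
rewrite linearZ /=; congr (_ *: _).
elim: {r}(r : nat) i j u => [|r IHr] i j u.
  by rewrite !expr0 !mxE; case: eqP => // _; rewrite ?linear0.
rewrite !exprS !mxE.
apply: etrans (congr1 psi (endo_sumE _ _)) _.
apply: etrans _ (esym (endo_sumE _ _)); rewrite linear_sum.
apply: eq_bigr => l _.
exact: etrans (MN i l _) (congr1 (N i l) (IHr l j u)).
Qed.

(** * Annihilating and minimal polynomials *)

Section MinimalPolynomial.
Variables (F : fieldType) (m : nat) (V : glmod F m).
Implicit Types p q : {poly F}.

Definition gl_mx : 'M[endo V]_m := \matrix_(i, j) gl_act V (delta_mx i j).

(** The action of [U(gl_m)] is an algebra morphism, so annihilation becomes the vanishing of a
    matrix over [endo V]. *)
Lemma ugl_act_horner q i j :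
  ugl_act V (ugl_horner m q i j) = mxeval q gl_mx i j.
Proof.
have map_pow r : map_mx (ugl_act V) (ugl_mx F m ^+ r) = gl_mx ^+ r.
  elim: r => [|r IHr]; first by rewrite !expr0 map_mx1.
  rewrite !exprS -IHr -[LHS]/(map_mx _ (_ *m _)) map_mxM; congr (_ *m _).
  apply/matrixP => a b; rewrite !mxE; exact: ugl_act_gen.
rewrite /ugl_horner /mxeval !summxE raddf_sum; apply: eq_bigr => r _ /=.
rewrite mxE rmorphM [RHS]mxE -map_pow [in RHS]mxE; congr (_ * _).
have ugl_actZ c x : ugl_act V (c *: x) = c *: ugl_act V x.
  by rewrite (linearZ_LR (ugl_act V)).
by rewrite [LHS]ugl_actZ rmorph1.
Qed.

Lemma annihilatesP q : annihilates V q <-> mxeval q gl_mx = 0.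
Proof.
split=> [Vq | q0 i j v]; last by rewrite ugl_act_horner q0 mxE.
apply/matrixP => i j; rewrite mxE; apply: endoP => v.
by rewrite -ugl_act_horner Vq.
Qed.

(** The remainder [p %% q] annihilates [V] as well; were it nonzero, its monic multiple would
    contradict minimality. *)
Lemma is_minpoly_dvdp q p : is_minpoly V q -> annihilates V p -> q %| p.
Proof.
move=> [qmon /annihilatesP Vq qmin] /annihilatesP Vp.
have Vr : mxeval (p %% q) gl_mx = 0.
  move: Vp; rewrite {1}(divp_eq p q) mxevalD mxevalM Vq.
  by rewrite mulr0 add0r.
apply/modp_eq0P/eqP/negPn/negP => r0.
have := qmin ((lead_coef (p %% q))^-1 *: (p %% q)).
rewrite size_scale ?invr_eq0 ?lead_coef_eq0 // leqNgt ltn_modp monic_neq0 //.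
move=> /(_ _ _)/negP; case => //.
  by rewrite monicE lead_coefZ mulVf // lead_coef_eq0.
by apply/annihilatesP; rewrite mxevalZ Vr scaler0.
Qed.
End MinimalPolynomial.

(* The factor [mxeval q L] is on the left: for [q] annihilating V' it sends all
   of A into A0, whereas the entries of [X] and [D] need not preserve A0. *)
Lemma mxeval_dual_euler_mx (F : fieldType) (A : lmodType F) (k n : nat)
    (X D : 'M[endo A]_(k, n)) (q : {poly F}) :
  (forall a i b j, X a i * X b j = X b j * X a i) ->
  (forall a i b j, D a i * D b j = D b j * D a i) ->
  (forall a i b j,
    D a i * X b j = X b j * D a i + ((a == b) && (i == j))%:R) ->
  mxeval ('X * (q \Po ('X + (k%:R - n%:R)%:P))) (X^T *m D) =
  (mxeval q (X *m D^T) *m X)^T *m D.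
Proof.
move=> XXC DDC DXC; set p := q \Po _.
have -> : mxeval q (X *m D^T) = mxeval p (X *m D^T + (n%:R - k%:R)%:M).
  have -> : n%:R - k%:R = (n%:R - k%:R) *: (1 : endo A).
    by rewrite scalerBl !scaler_nat.
  rewrite -mxeval_comp_shift -comp_polyA comp_polyD comp_polyX comp_polyC.
  by rewrite -addrA -polyCD -(opprB n%:R) subrr addr0 comp_polyXr.
rewrite mulrC mxevalMX {1}/mxeval mulr_suml mulmx_suml raddf_sum mulmx_suml.
(* The factor ['X] raises each exponent to [r.+1], the form that [dual_euler_mx_exp] covers. *)
apply: eq_bigr => r _; rewrite -[_ * _]/(_ *m _) -scalemxAl.
rewrite -[_ *m _]/(_ * _) -exprSr dual_euler_mx_exp //.
rewrite [LHS]scalemxAl -[in RHS]scalemxAl /=; congr (_ *m D).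
by apply/matrixP => i j; rewrite !mxE.
Qed.

(** * Annihilating polynomials under Howe duality *)

(** Stated for abstract matrices with the Weyl relations and a surjection [psi] onto a common module
    [T], so that both divisibilities are instances of it. *)
Lemma annihilates_of_howe (F : fieldType) (n k : nat) (A T : lmodType F)
    (V : glmod F n) (V' : glmod F k) (X D : 'M[endo A]_(k, n))
    (psi : {linear A -> T})
    (t : {rmorphism endo V -> endo T}) (t' : {rmorphism endo V' -> endo T})
    (q : {poly F}) :
  (forall a i b j, X a i * X b j = X b j * X a i) ->
  (forall a i b j, D a i * D b j = D b j * D a i) ->
  (forall a i b j,
    D a i * X b j = X b j * D a i + ((a == b) && (i == j))%:R) ->
  (forall x, exists u, psi u = x) ->
  scalable t -> scalable t' -> (forall f, t f = 0 -> f = 0) ->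
  (forall i j u, psi ((X^T *m D) i j u) = t (gl_mx V i j) (psi u)) ->
  (forall a b u, psi ((X *m D^T) a b u) = t' (gl_mx V' a b) (psi u)) ->
  annihilates V' q ->
  annihilates V ('X * (q \Po ('X + (k%:R - n%:R)%:P))).
Proof.
move=> XXC DDC DXC psi_surj tZ t'Z t_inj psiR psiL /annihilatesP V'q.
apply/annihilatesP/matrixP => i j; rewrite mxE; apply: t_inj; apply: endoP => x.
have [u <-] := psi_surj x.
set p := 'X * _.
have tE : psi (mxeval p (X^T *m D) i j u) = t (mxeval p (gl_mx V) i j) (psi u).
  rewrite (mxeval_intertwine (N := map_mx t (gl_mx V))).
    by rewrite mxeval_map // mxE.
  by move=> a b w; rewrite psiR [in RHS]mxE.
apply: etrans (esym tE) _.
have psiq0 a b w : psi (mxeval q (X *m D^T) a b w) = 0.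
  rewrite (mxeval_intertwine (N := map_mx t' (gl_mx V'))).
    by rewrite mxeval_map // V'q !mxE raddf0.
  by move=> c d v; rewrite psiL [in RHS]mxE.
(* Once expanded, every summand is an entry of [mxeval q (X *m D^T)] applied to some vector, and
   [psi] kills it. *)
rewrite mxeval_dual_euler_mx // mxE endo_sumE raddf_sum big1 // => b _.
rewrite mxE mxE mulr_suml endo_sumE raddf_sum big1 // => a _.
exact: psiq0.
Qed.

Theorem theorem6p3 (R : realType) (n k : nat) (hn : (1 <= n)%N)
    (hk : (1 <= k)%N) (V : glmod R[i] n) (V' : glmod R[i] k)
    (q q' : {poly R[i]}) :
  howe_dual V V' -> is_minpoly V q -> is_minpoly V' q' ->
  (q %| 'X * (q' \Po ('X + k%:R%:P - n%:R%:P))) /\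
  (q' %| 'X * (q \Po ('X - k%:R%:P + n%:R%:P))).
Proof.
move=> [[v v0] [v' v'0] [A [A0 [_ RA0 LA0 [phi [phi_bij phiR phiL]]]]]] qV q'V'.
have [_ Vq _] := qV; have [_ V'q' _] := q'V'.
pose X := map_mx (w_act A) (weyl_X R[i] k n).
pose D := map_mx (w_act A) (weyl_D R[i] k n).
have XXC a i b j : X a i * X b j = X b j * X a i.
  by rewrite !mxE -!rmorphM weyl_xxC.
have DDC a i b j : D a i * D b j = D b j * D a i.
  by rewrite !mxE -!rmorphM weyl_ddC.
have DXC a i b j :
    D a i * X b j = X b j * D a i + ((a == b) && (i == j))%:R.
  by rewrite !mxE -!rmorphM weyl_dx rmorphD rmorph_nat.
have XtD i j : (X^T *m D) i j = gl_act (pullback_R A) (delta_mx i j).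
  rewrite /= /wmod_R howe_R_delta raddf_sum mxE; apply: eq_bigr => a _.
  by rewrite !mxE /= rmorphM.
have XDt a b : (X *m D^T) a b = gl_act (pullback_L A) (delta_mx a b).
  rewrite /= /wmod_L howe_L_delta raddf_sum mxE; apply: eq_bigr => i _.
  by rewrite !mxE /= rmorphM.
have [phi' phi'K phiK] := phi_bij.
pose psi : {linear A -> tensor V V'} := phi \o quotmod_pi A0.
have psi_surj x : exists u, psi u = x.
  by exists (quotmod_repr (phi' x)); rewrite /= quotmod_reprK phiK.
have psiR i j u : psi ((X^T *m D) i j u) =
    endo_tensorl V' (gl_mx V i j) (psi u).
  rewrite XtD mxE; apply: etrans (phiR _ _).
  by rewrite quotmod_mapE //; apply: RA0.
have psiL a b u : psi ((X *m D^T) a b u) =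
    endo_tensorr V (gl_mx V' a b) (psi u).
  rewrite XDt mxE; apply: etrans (phiL _ _).
  by rewrite quotmod_mapE //; apply: LA0.
have tlZ : scalable (@endo_tensorl _ V V') by apply: linearZ_LR.
have trZ : scalable (@endo_tensorr _ V V') by apply: linearZ_LR.
have tl0 (f : endo V) : endo_tensorl V' f = 0 -> f = 0.
  by apply: endo_tensorl_eq0 v'0.
have tr0 (f : endo V') : endo_tensorr V f = 0 -> f = 0.
  by apply: endo_tensorr_eq0 v0.
split.
  apply: is_minpoly_dvdp qV _; rewrite -addrA -polyCB.
  exact: (annihilates_of_howe XXC DDC DXC psi_surj tlZ trZ tl0 psiR psiL V'q').
apply: is_minpoly_dvdp q'V' _; rewrite -addrA [- _ + _]addrC -polyCB.
(* Transposing [X] and [D] keeps the Weyl relations and exchanges the two Euler matrices, hence [n]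
   with [k] and [V] with [V']. *)
apply: (annihilates_of_howe (X := X^T) (D := D^T)) trZ tlZ tr0 _ _ Vq => //.
- by move=> a i b j; rewrite ![_^T _ _]mxE XXC.
- by move=> a i b j; rewrite ![_^T _ _]mxE DDC.
- by move=> a i b j; rewrite ![_^T _ _]mxE DXC andbC.
- by rewrite trmxK.
- by rewrite trmxK.
Qed.
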